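(* For each integer $n\ge 1$, let $C_{2n+2}$ be the bouquet with edge set $\{1,2,\dots,2n+2\}$ and signed rotation $$(1,\,2,\,3,\,4,\,5,\,6,\,\dots,\,2n+1,\,2n+2,\,-2,\,-1,\,2n+1,\,2n+2,\,\dots,\,5,\,6,\,3,\,4).$$ Then $C_{2n+2}$ is a counterexample to the statement ''the partial-dual Euler genus polynomial of every non-orientable ribbon graph is interpolating''; that is, $C_{2n+2}$ is a non-orientable ribbon graph and ${}^{\partial}\varepsilon_{C_{2n+2}}(z)$ is not interpolating. In particular, when $n=1$, $C_4$ is exactly the bouquet with signed rotation $(-1,-2,3,4,2,1,3,4)$.
   Context: A ribbon graph $G$ is a (possibly non-orientable) surface with boundary given as the union of vertex-discs $V(G)$ and edge-ribbons (discs) $E(G)$, where vertex-discs are pairwise disjoint, ribbons are pairwise disjoint, and each ribbon meets the vertex-discs in exactly two disjoint arcs (its ends, or half-edges), each lying on the boundary of exactly one vertex-disc. It is non-orientable if it is non-orientable as a surface. For a connected ribbon graph $G$ with $v$ vertices, $e$ edges and $f$ boundary components, the Euler genus $\varepsilon(G)$ is defined by $v-e+f=2-\varepsilon(G)$. For $A\subseteq E(G)$, the partial dual $G^A$ is the ribbon graph obtained by gluing a disc along each boundary component of the spanning ribbon subgraph $(V(G),A)$ (these discs are the vertices of $G^A$) and then removing the interiors of all original vertex-discs; its edges are the ribbons of $G$. The partial-dual Euler genus polynomial is ${}^{\partial}\varepsilon_G(z)=\sum_{A\subseteq E(G)}z^{\varepsilon(G^A)}$. A polynomial is interpolating if the set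 of exponents occurring with nonzero coefficient is an integer interval, i.e. consists of all integers between its minimum and its maximum. A bouquet is a ribbon graph with exactly one vertex. A signed rotation of a bouquet is the cyclic ordering of the half-edges around the vertex, each half-edge being written as the label of its edge together with a sign: the two half-edges of an edge get the same sign $+$ if the edge is an untwisted loop, and different signs (one $+$, one $-$) if it is a twisted loop. The sign $+$ is omitted. The signed rotation determines the bouquet; for a twisted loop it is immaterial which of its two half-edges carries the sign $-$. In the signed rotation of $C_{2n+2}$, after the entries $-2,-1$ the pairs $2i+1,2i+2$ occur in decreasing order of $i$, from $i=n$ to $i=1$, with $2i+1$ immediately followed by $2i+2$ in each pair. Thus edges $1,2$ are twisted and all other edges are untwisted. *)

(* Defs.v *)
From mathcomp Require Import all_boot all_order all_algebra.

Set Implicit Arguments.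
Unset Strict Implicit.
Unset Printing Implicit Defensive.

Import GRing.Theory.

(* Ribbon graphs, up to homeomorphism, with set of ribbons E.

   A flag is a corner of a ribbon, that is an endpoint of one of the two arcs
   in which the ribbon meets the vertex-discs.  Going round the boundary of a
   ribbon one meets its four flags, and alternately an end (an arc shared with
   a vertex-disc) and a side (an arc free of vertex-discs).  Going round the
   boundary of a vertex-disc that meets at least one ribbon one meets
   alternately an end and a corner (an arc free of ribbons).  Every flag is
   thus an endpoint of one end, one side and one corner, and
     - rend x, side x, corner x is the other endpoint of the end, side, corner
       that has x as an endpoint;
     - isolated is the number of vertex-discs that meet no ribbon. *)
Record ribbonGraph (E : finType) := RibbonGraph {
  flag : finType;
  edge_of : flag -> E;
  rend : flag -> flag;
  side : flag -> flag;
  corner : flag -> flag;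
  isolated : nat;
  rendK : involutive rend;
  sideK : involutive side;
  cornerK : involutive corner;
  rend_neq : forall x, rend x != x;
  side_neq : forall x, side x != x;
  corner_neq : forall x, corner x != x;
  rend_side_neq : forall x, rend x != side x;
  rend_sideC : forall x, rend (side x) = side (rend x);
  edge_ofP : forall x y,
    (edge_of x == edge_of y) = (y \in [:: x; rend x; side x; rend (side x)]);
  edge_of_surj : forall e, exists x, edge_of x = e }.

Section RibbonGraphs.
Variables (E : finType).
Implicit Type G : ribbonGraph E.

(* The boundary of a vertex-disc alternates ends and corners. *)
Definition nb_vertices G : nat :=
  n_comp [rel x y : flag G | (y == rend x) || (y == corner x)] predT
  + isolated G.

(* A boundary component of the surface alternates sides and corners, or is the
   boundary of an isolated vertex-disc. *)
Definition nb_boundary G : nat :=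
  n_comp [rel x y : flag G | (y == side x) || (y == corner x)] predT
  + isolated G.

Definition nb_components G : nat :=
  n_comp [rel x y : flag G | [|| y == rend x, y == side x | y == corner x]]
    predT
  + isolated G.

(* v - e + f = 2 - euler_genus when G is connected; in general the Euler genus
   is additive over the connected components. *)
Definition euler_genus G : int :=
  ((2 * nb_components G)%N%:Z
   - ((nb_vertices G)%:Z - #|E|%:Z + (nb_boundary G)%:Z))%R.

(* An orientation of a disc directs its boundary.  The functions ov and oe stand
   for orientations of the vertex-discs and of the ribbons: ov x (resp. oe x)
   tells whether the end containing x starts at x, in the direction given by its
   vertex-disc (resp. ribbon).  The surface is oriented if the two discs
   sharing an end always direct it oppositely. *)
Definition orientable G : Prop :=
  exists ov oe : flag G -> bool,
    [/\ forall x, ov (rend x) = ~~ ov x /\ ov (corner x) = ~~ ov x,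
        forall x, oe (rend x) = ~~ oe x /\ oe (side x) = ~~ oe x
      & forall x, oe x = ~~ ov x].

(* Homeomorphism of ribbon graphs preserving the names of the ribbons. *)
Definition ribbon_iso G H : Prop :=
  isolated G = isolated H /\
  exists f : flag G -> flag H,
    [/\ bijective f,
        forall x, edge_of (f x) = edge_of x,
        forall x, f (rend x) = rend (f x),
        forall x, f (side x) = side (f x)
      & forall x, f (corner x) = corner (f x)].

Lemma edge_of_rend G (x : flag G) : edge_of (rend x) = edge_of x.
Proof. by apply/esym/eqP; rewrite edge_ofP !inE eqxx orbT. Qed.

Lemma edge_of_side G (x : flag G) : edge_of (side x) = edge_of x.
Proof. by apply/esym/eqP; rewrite edge_ofP !inE eqxx !orbT. Qed.

Section PartialDual.
Variables (G : ribbonGraph E) (A : {set E}).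

(* The boundary of the spanning ribbon subgraph (V(G), A) is made of the
   corners of G, the sides of the ribbons in A and the ends of the other
   ribbons.  It bounds the vertex-discs of the partial dual, in which a ribbon
   of A is therefore attached along its former sides.  The boundary of an
   isolated vertex-disc bounds an isolated vertex-disc. *)
Definition dual_rend (x : flag G) : flag G :=
  if edge_of x \in A then side x else rend x.

Definition dual_side (x : flag G) : flag G :=
  if edge_of x \in A then rend x else side x.

Lemma dual_rendK : involutive dual_rend.
Proof.
move=> x; rewrite /dual_rend; case: (boolP (edge_of x \in A)) => Ax.
  by rewrite edge_of_side Ax sideK.
by rewrite edge_of_rend (negbTE Ax) rendK.
Qed.

Lemma dual_sideK : involutive dual_side.
Proof.
move=> x; rewrite /dual_side; case: (boolP (edge_of x \in A)) => Ax.
  by rewrite edge_of_rend Ax rendK.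
by rewrite edge_of_side (negbTE Ax) sideK.
Qed.

Lemma dual_rend_neq x : dual_rend x != x.
Proof. by rewrite /dual_rend; case: ifP; rewrite ?side_neq ?rend_neq. Qed.

Lemma dual_side_neq x : dual_side x != x.
Proof. by rewrite /dual_side; case: ifP; rewrite ?side_neq ?rend_neq. Qed.

Lemma dual_rend_side_neq x : dual_rend x != dual_side x.
Proof.
rewrite /dual_rend /dual_side; case: ifP => _; last exact: rend_side_neq.
by rewrite eq_sym rend_side_neq.
Qed.

Lemma dual_rend_sideC x : dual_rend (dual_side x) = dual_side (dual_rend x).
Proof.
rewrite /dual_rend /dual_side; case: (boolP (edge_of x \in A)) => Ax.
  by rewrite edge_of_rend edge_of_side Ax rend_sideC.
by rewrite edge_of_rend edge_of_side (negbTE Ax) rend_sideC.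
Qed.

Lemma dual_edge_ofP x y :
  (edge_of x == edge_of y)
  = (y \in [:: x; dual_rend x; dual_side x; dual_rend (dual_side x)]).
Proof.
rewrite edge_ofP /dual_rend /dual_side; case: (boolP (edge_of x \in A)) => Ax.
  rewrite edge_of_rend Ax -rend_sideC !inE.
  by rewrite [(y == rend x) || _]orbCA.
by rewrite edge_of_side (negbTE Ax).
Qed.

Definition partial_dual : ribbonGraph E :=
  RibbonGraph (isolated G) dual_rendK dual_sideK (@cornerK _ G)
    dual_rend_neq dual_side_neq (@corner_neq _ G)
    dual_rend_side_neq dual_rend_sideC dual_edge_ofP (@edge_of_surj _ G).

End PartialDual.

Local Open Scope ring_scope.

(* Euler genera are nonnegative, so the absolute value only serves to turn an
   integer into an exponent. *)
Definition partial_dual_polynomial G : {poly int} :=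
  \sum_(A : {set E}) 'X^(`|euler_genus (partial_dual G A)|%N).

End RibbonGraphs.

Definition interpolating (p : {poly int}) : Prop :=
  forall i j k : nat, (i <= j <= k)%N ->
    (p`_i != 0)%R -> (p`_k != 0)%R -> (p`_j != 0)%R.

Section Bouquets.
Local Open Scope ring_scope.

(* The edge set {1, ..., m}. *)
Definition label (m : nat) : finType := seq_sub (iota 1 m).

(* Signed rotations with edge set {1, ..., m}: the half-edges, read around the
   vertex, are the entries of s; their labels are the absolute values, and each
   label occurs exactly twice. *)
Definition signed_rotation (m : nat) (s : seq int) : bool :=
  perm_eq [seq `|x|%N | x <- s] (iota 1 m ++ iota 1 m).

Variables (m : nat) (s : seq int).
Hypothesis rot_s : signed_rotation m s.

Lemma half_label_subproof (i : 'I_(size s)) : `|(s`_i)%R|%N \in iota 1 m.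
Proof.
have: `|(s`_i)%R|%N \in [seq `|x|%N | x <- s] by rewrite map_f // mem_nth.
by rewrite (perm_mem rot_s) mem_cat orbb.
Qed.

Definition half_label (i : 'I_(size s)) : label m :=
  SeqSub (half_label_subproof i).

(* The other half-edge of the same edge. *)
Definition partner (i : 'I_(size s)) : 'I_(size s) :=
  odflt i [pick j | (j != i) && (half_label j == half_label i)].

(* The flag (i, false) is the point where one enters the half-edge i, and
   (i, true) the point where one leaves it, when going round the vertex. *)
Definition bouquet_flag : finType := ('I_(size s) * bool)%type.

Definition bouquet_edge_of (x : bouquet_flag) : label m := half_label x.1.

Definition bouquet_rend (x : bouquet_flag) : bouquet_flag := (x.1, ~~ x.2).

(* Sides join an entry point to an exit point in an untwisted loop, where the
   signs agree, and join points of the same kind in a twisted loop. *)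
Definition bouquet_side (x : bouquet_flag) : bouquet_flag :=
  (partner x.1,
   if (s`_(x.1) < 0) == (s`_(partner x.1) < 0) then ~~ x.2 else x.2).

Definition bouquet_corner (x : bouquet_flag) : bouquet_flag :=
  if x.2 then (ordS x.1, false) else (ord_pred x.1, true).

Lemma card_half_label (e : label m) : #|[pred i | half_label i == e]| = 2.
Proof.
have ->: 2 = count_mem (val e) [seq `|x|%N | x <- s].
  rewrite (permP rot_s) count_cat !count_uniq_mem ?iota_uniq //.
  by rewrite (valP e).
rewrite count_map -sum1_count (big_nth 0) big_mkord -sum1_card.
by apply: eq_bigl => i; rewrite inE -val_eqE.
Qed.

Lemma partnerP (i : 'I_(size s)) :
  (partner i != i) /\
  forall j, (half_label j == half_label i) = (j == i) || (j == partner i).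
Proof.
have card2 := card_half_label (half_label i).
rewrite (cardD1 i) inE eqxx add1n in card2.
have [k hk] := mem_card1 (succn_inj card2).
have Ek : partner i = k.
  rewrite /partner; case: pickP => [j Pj | noj] /=.
    by have := hk j; rewrite !inE Pj => /esym/eqP.
  by have := noj k; have := hk k; rewrite !inE eqxx => ->.
rewrite Ek; have := hk k; rewrite !inE eqxx => /andP[ki _].
split=> // j; have := hk j; rewrite !inE.
by case: (eqVneq j i) => [->|] //=; rewrite eqxx.
Qed.

Lemma partner_neq i : partner i != i.
Proof. by have [] := partnerP i. Qed.

Lemma half_labelE i j :
  (half_label j == half_label i) = (j == i) || (j == partner i).
Proof. by have [_ ->] := partnerP i. Qed.

Lemma partnerK : involutive partner.
Proof.
move=> i; apply/esym/eqP.
have: half_label i == half_label (partner i).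
  by rewrite eq_sym half_labelE eqxx orbT.
by rewrite half_labelE eq_sym (negbTE (partner_neq i)).
Qed.

Lemma bouquet_rendK : involutive bouquet_rend.
Proof. by case=> i b; rewrite /bouquet_rend /= negbK. Qed.

Lemma bouquet_sideK : involutive bouquet_side.
Proof.
case=> i b; rewrite /bouquet_side /= partnerK.
by case: (s`_i < 0) (s`_(partner i) < 0) => [] []; rewrite /= ?negbK.
Qed.

Lemma bouquet_cornerK : involutive bouquet_corner.
Proof. by case=> i [] /=; rewrite /bouquet_corner /= ?ordSK ?ord_predK. Qed.

Lemma bouquet_rend_neq x : bouquet_rend x != x.
Proof. by case: x => i []; rewrite /bouquet_rend xpair_eqE /= andbF. Qed.

Lemma bouquet_side_neq x : bouquet_side x != x.
Proof.
by case: x => i b; rewrite /bouquet_side xpair_eqE (negbTE (partner_neq i)).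
Qed.

Lemma bouquet_corner_neq x : bouquet_corner x != x.
Proof. by case: x => i []; rewrite /bouquet_corner xpair_eqE /= andbF. Qed.

Lemma bouquet_rend_side_neq x : bouquet_rend x != bouquet_side x.
Proof.
case: x => i b; rewrite /bouquet_rend /bouquet_side xpair_eqE /= eq_sym.
by rewrite (negbTE (partner_neq i)).
Qed.

Lemma bouquet_rend_sideC x :
  bouquet_rend (bouquet_side x) = bouquet_side (bouquet_rend x).
Proof. by case: x => i b; rewrite /bouquet_rend /bouquet_side /=; case: ifP. Qed.

Lemma bouquet_edge_ofP x y :
  (bouquet_edge_of x == bouquet_edge_of y)
  = (y \in [:: x; bouquet_rend x; bouquet_side x;
               bouquet_rend (bouquet_side x)]).
Proof.
case: x y => [i b] [j c]; rewrite /bouquet_edge_of eq_sym half_labelE !inE.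
rewrite /bouquet_rend /bouquet_side !xpair_eqE /= orbA -!andb_orr.
have E2 (d : bool) : (c == d) || (c == ~~ d) by case: c d => [] [].
by rewrite !E2 !andbT.
Qed.

Lemma bouquet_edge_of_surj e : exists x, bouquet_edge_of x = e.
Proof.
have: (0 < #|[pred i | half_label i == e]|)%N by rewrite card_half_label.
by case/card_gt0P => i /eqP <-; exists (i, true).
Qed.

(* Without ribbons, the bouquet is a single isolated vertex-disc. *)
Definition bouquet : ribbonGraph (label m) :=
  RibbonGraph (m == 0%N) bouquet_rendK bouquet_sideK bouquet_cornerK
    bouquet_rend_neq bouquet_side_neq bouquet_corner_neq
    bouquet_rend_side_neq bouquet_rend_sideC
    bouquet_edge_ofP bouquet_edge_of_surj.

Lemma size_signed_rotation : size s = (m + m)%N.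
Proof. by rewrite -(size_map absz) (perm_size rot_s) size_cat !size_iota. Qed.

Lemma nb_vertices_bouquet : nb_vertices bouquet = 1%N.
Proof.
rewrite /nb_vertices /=; set r := (X in n_comp X _).
have sym_r : connect_sym r.
  apply: sym_connect_sym => x y /=; congr (_ || _).
    by apply/eqP/eqP=> ->; rewrite bouquet_rendK.
  by apply/eqP/eqP=> ->; rewrite bouquet_cornerK.
have [m0 | m_gt0] := posnP m.
  rewrite /= addn1; congr _.+1; apply: eq_card0 => -[[i lt_i] b].
  by exfalso; move: lt_i; rewrite size_signed_rotation m0.
rewrite addn0.
have s_gt0 : (0 < size s)%N by rewrite size_signed_rotation addn_gt0 m_gt0.
pose x0 : bouquet_flag := (Ordinal s_gt0, false).
have conn k (lt_k : (k < size s)%N) b : connect r x0 (Ordinal lt_k, b).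
  elim: k lt_k b => [|k IHk] lt_k b.
    have -> : Ordinal lt_k = Ordinal s_gt0 by apply: val_inj.
    case: b; last exact: connect0.
    by apply: connect1; apply/orP; left; apply/eqP.
  suff conn_k : connect r x0 (Ordinal lt_k, false).
    case: b => //; apply: connect_trans conn_k (connect1 _).
    by apply/orP; left; apply/eqP.
  apply: connect_trans (IHk (ltnW lt_k) true) (connect1 _).
  apply/orP; right; apply/eqP; rewrite /= /bouquet_corner /=.
  by congr (_, _); apply: val_inj; rewrite /= modn_small.
rewrite -(n_comp_connect sym_r x0); apply: eq_n_comp_r => -[[k lt_k] b].
by rewrite !inE conn.
Qed.

End Bouquets.

Section Counterexample.
Local Open Scope ring_scope.

Definition C_rotation (n : nat) : seq int :=
  [seq k%:Z | k <- iota 1 (2 * n + 2)] ++ [:: -2; -1]%Z ++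
  flatten [seq [:: (2 * i + 1)%N%:Z; (2 * i + 2)%N%:Z] | i <- rev (iota 1 n)].

Lemma C_rotationP n : signed_rotation (2 * n + 2) (C_rotation n).
Proof.
rewrite /signed_rotation /C_rotation map_cat -map_comp.
rewrite (@eq_map _ _ _ id) // map_id perm_cat2l map_cat /=.
elim: n => [|n IHn] //.
have -> : (2 * n.+1 + 2 = 2 * n + 2 + 2)%N by rewrite mulnS [(2 + _)%N]addnC.
rewrite [iota 1 (_ + 2)]iotaD -{1}(addn1 n) [iota 1 (n + 1)]iotaD.
rewrite rev_cat /=.
have -> : (2 * (1 + n) + 1 = 1 + (2 * n + 2))%N.
  by rewrite mulnDr addnC [(_ * 1 + _)%N]addnC.
have -> : (2 * (1 + n) + 2 = (1 + (2 * n + 2)).+1)%N.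
  by rewrite mulnDr [(_ * 1 + _)%N]addnC addnC.
set F := [seq _ | _ <- _]; set ab := [:: _; _].
have := perm_cat IHn (perm_refl ab); apply: perm_trans.
by rewrite (perm_cat2l [:: 2%N; 1%N] (ab ++ F) (F ++ ab)) perm_catC.
Qed.

Definition bouquet_C (n : nat) : ribbonGraph (label (2 * n + 2)) :=
  bouquet (C_rotationP n).

End Counterexample.

(* Main.v *)
Require Import Defs.
From mathcomp Require Import all_boot all_order all_algebra.
From mathcomp Require Import zify.

Set Implicit Arguments.
Unset Strict Implicit.
Unset Printing Implicit Defensive.

Import GRing.Theory Num.Theory.

(** Colour the corners of the bouquet alternately while going round its vertex.
    In C_(2n+2) the side of a ribbon, like an end, always joins two corners of
    different colours: an untwisted loop has its two half-edges at positions of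
    the same parity, a twisted one at positions of different parities.  Hence
    opposite flags of a ribbon (those exchanged by rend o side) lie on corners
    of the same colour.  Let t exchange opposite flags on the odd corners and
    fix the flags on the even ones.  Since t moves exactly one flag of each end
    and of each side, it exchanges ends and sides; and since the labels 2i+1 and
    2i+2 are neighbours at both of their occurrences, in the same order if they
    are untwisted and in the opposite order for the twisted 1 and 2, it maps
    odd corners to odd corners.

    Partial duality only exchanges ends and sides in some of the ribbons, so
    the same t exchanges ends and sides in every partial dual and identifies its
    vertices with its boundary components (checkerboard_nb_boundary).  The Euler
    genus of the partial dual along A is therefore
      2c + (2n + 2) - 2v(A)
    where c counts the components and v(A) the vertices of the partial dual.
    Only even exponents occur.  Two of them that differ by 2 do occur: v is 1
    for A empty, and 2 for A = {3}, an untwisted loop (nb_vertices_label3).  The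
    odd number between them is a gap.  The bouquet is not orientable because
    edge 1 is a twisted loop. *)

(** * Counting components *)

Section Components.
Variable T : finType.

Lemma involutions_connect_sym (f g : T -> T) :
  involutive f -> involutive g ->
  connect_sym [rel x y | (y == f x) || (y == g x)].
Proof.
move=> fK gK; apply: sym_connect_sym => x y /=.
by rewrite ![y == _]eq_sym (inv_eq fK) (inv_eq gK).
Qed.

Lemma n_comp_morph (e e' : rel T) (t : T -> T) :
  connect_sym e -> connect_sym e' -> involutive t ->
  (forall x y, e x y -> e' (t x) (t y)) ->
  (forall x y, e' x y -> e (t x) (t y)) ->
  n_comp e predT = n_comp e' predT.
Proof.
move=> syme syme' tK ee' e'e.
have lift (r r' : rel T) : (forall x y, r x y -> r' (t x) (t y)) ->
    forall x y, connect r x y -> connect r' (t x) (t y).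
  move=> rr' x y /connectP[p]; elim: p x => [|z p IHp] x /=.
    by move=> _ ->; apply: connect0.
  case/andP=> xz zp yz; apply: connect_trans (connect1 (rr' _ _ xz)) _.
  exact: IHp zp yz.
apply: (adjunction_n_comp t) => //; split=> [x _ | x y _].
  by exists (t x); rewrite tK.
by apply/idP/idP => [/(lift _ _ e'e) | /(lift _ _ ee')]; rewrite ?tK.
Qed.

(** A closed part and its complement, both connected, are the two components. *)
Lemma n_comp_two (e : rel T) (a : pred T) (x y : T) :
  connect_sym e -> closed e a -> a x -> ~~ a y ->
  (forall z, a z -> connect e x z) -> (forall z, ~~ a z -> connect e y z) ->
  n_comp e predT = 2.
Proof.
move=> syme cl ax ay connx conny; rewrite (n_compC a).
have clC u v : connect e u v -> a u = a v by move/(closed_connect cl).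
have ->: n_comp e a = 1.
  rewrite -(n_comp_connect syme x); apply: eq_n_comp_r => z; rewrite !inE.
  by apply/idP/idP => [/connx | /clC axz]; last rewrite unfold_in -axz.
congr (1 + _); rewrite -(n_comp_connect syme y).
apply: eq_n_comp_r => z; rewrite !inE.
by apply/idP/idP => [/conny | /clC ayz]; last rewrite unfold_in -ayz.
Qed.

End Components.

(** * Ribbon graphs with a checkerboard colouring *)

Section SelfDual.
Variables (E : finType) (G : ribbonGraph E).

(** The last condition says that exchanging opposite flags of ribbons carries
    each corner of colour true to a corner. *)
Definition checkerboard (chi : flag G -> bool) : Prop :=
  [/\ forall x, chi (rend x) = ~~ chi x,
      forall x, chi (side x) = ~~ chi x,
      forall x, chi (corner x) = chi x
    & forall x, chi x -> rend (side (corner x)) = corner (rend (side x))].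

(** Exchanging opposite flags on one of the two colours is an involution that
    respects corners and edges and turns ends into sides.  The edge labels being
    respected, it also turns the ends of any partial dual into its sides. *)
Lemma checkerboard_nb_boundary chi (A : {set E}) : checkerboard chi ->
  nb_boundary (partial_dual G A) = nb_vertices (partial_dual G A).
Proof.
case=> chir chis chic chiC.
pose t (x : flag G) := if chi x then rend (side x) else x.
have tK : involutive t.
  move=> x; rewrite /t; case: (boolP (chi x)) => [cx | /negbTE-> //].
  by rewrite chir chis negbK cx rend_sideC rendK sideK.
have tc x : t (corner x) = corner (t x).
  by rewrite /t chic; case: ifP => // /chiC.
have edge_t x : edge_of (t x) = edge_of x.
  by rewrite /t; case: ifP; rewrite ?edge_of_rend ?edge_of_side.
have tr x : t (rend x) = side (t x).
  by rewrite /t chir; case: (chi x); rewrite /= -rend_sideC ?sideK ?rendK.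
have ts x : t (side x) = rend (t x) by rewrite -{1}[x]tK -tr tK.
have tdr x : t (dual_rend A x) = dual_side A (t x).
  by rewrite /dual_rend /dual_side edge_t; case: ifP.
have tds x : t (dual_side A x) = dual_rend A (t x).
  by rewrite -{1}[x]tK -tdr tK.
congr (_ + _).
apply: (n_comp_morph (t := t)) tK _ _.
- exact: (involutions_connect_sym (@dual_sideK _ G A) (@cornerK _ G)).
- exact: (involutions_connect_sym (@dual_rendK _ G A) (@cornerK _ G)).
- by move=> x y /= /orP[] /eqP->; rewrite ?tds ?tc eqxx ?orbT.
- by move=> x y /= /orP[] /eqP->; rewrite ?tdr ?tc eqxx ?orbT.
Qed.

Lemma nb_components_partial_dual (A : {set E}) :
  nb_components (partial_dual G A) = nb_components G.
Proof.
congr (_ + _); apply: eq_n_comp => x y; apply: eq_connect => {}x {}y /=.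
rewrite /dual_rend /dual_side; case: ifP => //= _.
by rewrite orbCA.
Qed.

Lemma nb_vertices_dual0 : nb_vertices (partial_dual G set0) = nb_vertices G.
Proof.
congr (_ + _); apply: eq_n_comp => x y; apply: eq_connect => {}x {}y /=.
by rewrite /dual_rend inE.
Qed.

(** In particular the parity of the Euler genus is that of the number of edges,
    whatever A is. *)
Lemma checkerboard_euler_genus chi (A : {set E}) : checkerboard chi ->
  euler_genus (partial_dual G A)
  = ((2 * nb_components G + #|E|)%N%:Z
     - (2 * nb_vertices (partial_dual G A))%N%:Z)%R.
Proof.
move=> chiP; rewrite /euler_genus nb_components_partial_dual.
rewrite (checkerboard_nb_boundary _ chiP); lia.
Qed.

(** The coefficients count sets of edges, so no cancellation occurs. *)
Lemma coef_partial_dual_polynomial k :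
  ((partial_dual_polynomial G)`_k != 0)%R
  <-> exists A : {set E}, `|euler_genus (partial_dual G A)|%N = k.
Proof.
have ->: ((partial_dual_polynomial G)`_k
    = #|[pred A | `|euler_genus (partial_dual G A)|%N == k]|%:R)%R.
  rewrite coef_sum -sum1_card natr_sum [RHS]big_mkcond.
  by apply: eq_bigr => A _; rewrite coefXn inE eq_sym; case: eqP.
rewrite pnatr_eq0 -lt0n; split=> [/card_gt0P[A] | [A Ak]].
  by rewrite inE => /eqP; exists A.
by apply/card_gt0P; exists A; rewrite inE Ak.
Qed.

End SelfDual.

(** * Bouquets *)

Section BouquetLemmas.
Variables (m : nat) (s : seq int) (rot_s : signed_rotation m s).

Lemma partnerE (i j : 'I_(size s)) :
  j != i -> `|(s`_j)%R|%N = `|(s`_i)%R|%N -> partner rot_s i = j.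
Proof.
move=> ji sji; have: half_label rot_s j == half_label rot_s i.
  by apply/eqP/val_inj.
by rewrite half_labelE (negbTE ji) /= => /eqP.
Qed.

(** Going round the vertex, the orientation of the disc gives the same value at
    all entry points.  The side of a twisted loop joins its two entry points,
    where the orientation of its ribbon would have to take opposite values. *)
Lemma twisted_not_orientable (i : 'I_(size s)) :
  ((s`_i < 0) != (s`_(partner rot_s i) < 0))%R ->
  ~ orientable (bouquet rot_s).
Proof.
move=> tw [ov [oe [ovP oeP oeov]]].
have s_gt0 : 0 < size s by apply: leq_ltn_trans (ltn_ord i).
have ovE (j : 'I_(size s)) : ov (j, false) = ov (Ordinal s_gt0, false).
  case: j => k; elim: k => [|k IHk] lt_k.
    by congr (ov (_, _)); apply: val_inj.
  rewrite -(IHk (ltnW lt_k)); have [r _] := ovP (Ordinal (ltnW lt_k), true).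
  have [_ c] := ovP (Ordinal (ltnW lt_k), true).
  rewrite -[RHS]/(ov (rend ((Ordinal (ltnW lt_k), true)
                            : flag (bouquet rot_s)))) r -c.
  congr (ov (_, _)); apply: val_inj => /=.
  by rewrite modn_small.
have [_] := oeP (i, false); rewrite !oeov /= /bouquet_side /= (negbTE tw).
by rewrite !ovE; case: (ov _).
Qed.

End BouquetLemmas.

(** * The signed rotation of C *)

Section Rotation.
Variable n : nat.
Local Notation s := (C_rotation n).

Lemma size_C : size s = 4 * n + 4.
Proof. by rewrite (size_signed_rotation (C_rotationP n)); lia. Qed.

Lemma nth_flatten_pairs (U T : Type) (x0 : T) (u0 : U) (f g : U -> T) l t :
  t < size l ->
  nth x0 (flatten [seq [:: f u; g u] | u <- l]) t.*2 = f (nth u0 l t) /\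
  nth x0 (flatten [seq [:: f u; g u] | u <- l]) t.*2.+1 = g (nth u0 l t).
Proof.
by elim: l t => [|u l IHl] [|t] //= lt_t; apply: IHl.
Qed.

Lemma nth_C_first k : k <= 2 * n + 1 -> (s`_k = k.+1%:Z)%R.
Proof.
move=> le_k; rewrite nth_cat size_map size_iota ifT; last lia.
by rewrite (nth_map 0) ?size_iota ?nth_iota //; lia.
Qed.

Lemma nth_C_twisted : (s`_(2 * n + 2) = -2 /\ s`_(2 * n + 3) = -1)%R.
Proof.
split; rewrite nth_cat size_map size_iota ifF; try lia; first by rewrite subnn.
by have -> : 2 * n + 3 - (2 * n + 2) = 1 by lia.
Qed.

Lemma nth_C_second i : 0 < i <= n ->
  (s`_(4 * n + 4 - 2 * i) = (2 * i + 1)%N%:Z /\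
   s`_(4 * n + 5 - 2 * i) = (2 * i + 2)%N%:Z)%R.
Proof.
move=> lt_i; rewrite /C_rotation catA.
set u := (_ ++ [:: _; _]); have size_u : size u = 2 * n + 4.
  by rewrite size_cat size_map size_iota /=; lia.
rewrite [nth _ _ (4 * n + 4 - _)]nth_cat [nth _ _ (4 * n + 5 - _)]nth_cat.
rewrite size_u !ifF; try lia.
have -> : (4 * n + 4 - 2 * i - (2 * n + 4)) = (n - i).*2 by lia.
have -> : (4 * n + 5 - 2 * i - (2 * n + 4)) = (n - i).*2.+1 by lia.
have lt_ni : n - i < size (rev (iota 1 n)) by rewrite size_rev size_iota; lia.
have [/= -> ->] := nth_flatten_pairs 0%R 0
  (fun i => Posz (2 * i + 1)) (fun i => Posz (2 * i + 2)) lt_ni.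
rewrite nth_rev size_iota ?nth_iota; lia.
Qed.


(** The rotation is a sequence of 2n+2 blocks of two entries.  The two labels of
    block t occur again together in a unique other block r, in the same order if
    the loops are untwisted and in the opposite order if they are twisted. *)
Lemma C_pairs t : t < 2 * n + 2 -> exists r (tw : bool),
  [/\ (r < 2 * n + 2) && (r != t),
      `|(s`_(t.*2))%R|%N = `|(s`_(r.*2 + tw))%R|%N,
      `|(s`_(t.*2 + 1))%R|%N = `|(s`_(r.*2 + ~~ tw))%R|%N,
      ((s`_(t.*2) < 0) == (s`_(r.*2 + tw) < 0) = ~~ tw)%R
    & ((s`_(t.*2 + 1) < 0) == (s`_(r.*2 + ~~ tw) < 0) = ~~ tw)%R].
Proof.
move=> lt_t; have [tw2 tw1] := nth_C_twisted.
have e2 : n.+1.*2 = 2 * n + 2 by lia.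
have e3 : 2 * n + 2 + 1 = 2 * n + 3 by lia.
have [-> | t_gt0] := posnP t.
  (* The block 1, 2 meets the block -2, -1, which has index n + 1. *)
  exists n.+1, true; rewrite -[nat_of_bool true]/1 -[nat_of_bool (~~ true)]/0 addn0.
  rewrite e2 e3 tw1 tw2 !nth_C_first; try lia.
  by split=> //; lia.
have [-> | t_neq] := eqVneq t n.+1.
  exists 0, true; rewrite -[nat_of_bool true]/1 -[nat_of_bool (~~ true)]/0 addn0.
  rewrite e2 e3 tw1 tw2 !nth_C_first; try lia.
  by split=> //; lia.
(* The block of index i >= 1 in the first half is 2i+1, 2i+2, which occurs again
   as the block of index 2n + 2 - i. *)
exists (2 * n + 2 - t), false; rewrite /= !addn0.
have [le_tn | lt_nt] := leqP t n.
  have [] := @nth_C_second t _; first by lia.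
  have -> : 4 * n + 4 - 2 * t = (2 * n + 2 - t).*2 by lia.
  have -> : 4 * n + 5 - 2 * t = (2 * n + 2 - t).*2 + 1 by lia.
  move=> -> ->; rewrite !nth_C_first; try lia.
  by split; lia.
have [] := @nth_C_second (2 * n + 2 - t) _; first by lia.
have -> : 4 * n + 4 - 2 * (2 * n + 2 - t) = t.*2 by lia.
have -> : 4 * n + 5 - 2 * (2 * n + 2 - t) = t.*2 + 1 by lia.
move=> -> ->; rewrite !nth_C_first; try lia.
by split; lia.
Qed.

(** The sides of the ribbons of a block: this is all that the checkerboard
    property needs to know about the rotation. *)
Lemma side_C t (lt0 : t.*2 < size s) (lt1 : t.*2 + 1 < size s) :
  exists (r : nat) (tw : bool) (lt_r : r.*2 + tw < size s)
         (lt_r' : r.*2 + ~~ tw < size s),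
  [/\ forall b, bouquet_side (C_rotationP n) (Ordinal lt0, b)
                = (Ordinal lt_r, b (+) ~~ tw)
    & forall b, bouquet_side (C_rotationP n) (Ordinal lt1, b)
                = (Ordinal lt_r', b (+) ~~ tw)].
Proof.
have /C_pairs[r [tw [/andP[lt_r rt] e0 e1 s0 s1]]] : t < 2 * n + 2.
  by move: lt1; rewrite size_C; lia.
have lt2 : r.*2 + tw < size s by rewrite size_C; case: tw {e0 e1 s0 s1}; lia.
have lt3 : r.*2 + ~~ tw < size s.
  by rewrite size_C; case: tw {e0 e1 s0 s1 lt2}; lia.
exists r, tw, lt2, lt3; rewrite /bouquet_side /=.
have -> : partner (C_rotationP n) (Ordinal lt0) = Ordinal lt2.
  apply: partnerE => //; rewrite -val_eqE /=.
  by case: tw {e0 e1 s0 s1 lt2 lt3}; lia.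
have -> : partner (C_rotationP n) (Ordinal lt1) = Ordinal lt3.
  apply: partnerE => //; rewrite -val_eqE /=.
  by case: tw {e0 e1 s0 s1 lt2 lt3}; lia.
by rewrite /= s0 s1; split=> b; case: tw {e0 e1 s0 s1} lt2 lt3; case: b.
Qed.

Lemma ord_double (k : 'I_(size s)) : exists t (lt0 : t.*2 < size s)
  (lt1 : t.*2 + 1 < size s), k = Ordinal lt0 \/ k = Ordinal lt1.
Proof.
have lt_k := ltn_ord k; have sz := size_C.
have lt0 : k./2.*2 < size s by lia.
have lt1 : k./2.*2 + 1 < size s by lia.
exists k./2, lt0, lt1; case: (boolP (odd k)) => k_odd.
  by right; apply: val_inj => /=; lia.
by left; apply: val_inj => /=; lia.
Qed.

(** The flag (k, b) lies on the corner number k + b, where corner k precedes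
    position k; the colour is the parity of this number.  It is well defined on
    the last corner, which is also the first, as the number of positions is
    even.  An odd corner is the one between the two entries of a block. *)
Lemma checkerboard_C :
  checkerboard (G := bouquet_C n) (fun x => odd (x.1 : 'I_(size s)) (+) x.2).
Proof.
set chi := (fun x => _).
have chir (x : flag (bouquet_C n)) : chi (rend x) = ~~ chi x.
  by case: x => k b; rewrite /chi /= addbN.
have chis (x : flag (bouquet_C n)) : chi (side x) = ~~ chi x.
  case: x => k b; have [t [lt0 [lt1 k_t]]] := ord_double k.
  have [r [tw [ltr [ltr' [s0 s1]]]]] := side_C lt0 lt1.
  case: k_t => ->; [rewrite [side _](s0 b) | rewrite [side _](s1 b)].
    by rewrite /chi /= oddD !odd_double; case: tw b {ltr ltr' s0 s1} => [] [].
  by rewrite /chi /= !oddD !odd_double; case: tw b {ltr ltr' s0 s1} => [] [].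
have chic (x : flag (bouquet_C n)) : chi (corner x) = chi x.
  case: x => k b; rewrite /chi /= /bouquet_corner /=.
  have sz := size_C; have ltk := ltn_ord k.
  have odd_size : odd (size s) = false by rewrite size_C; lia.
  by case: b => /=; rewrite odd_mod //; lia.
have chiC (k : 'I_(size s)) (x := (k, true) : flag (bouquet_C n)) :
    ~~ odd k -> rend (side (corner x)) = corner (rend (side x)).
  move=> k_even; have [t [lt0 [lt1 k_t]]] := ord_double k.
  have [r [tw [ltr [ltr' [s0 s1]]]]] := side_C lt0 lt1.
  rewrite /x; case: k_t k_even => -> /=; last by rewrite oddD odd_double.
  move=> _; rewrite s0 /bouquet_corner /=.
  have -> : ordS (Ordinal lt0) = Ordinal lt1.
    by apply: val_inj; rewrite /= modn_small -addn1.
  rewrite s1 /bouquet_rend /=.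
  case: tw ltr ltr' {s0 s1} => /= ltr ltr'; congr (_, _); apply: val_inj => /=.
    rewrite addnAC addn1 /= modnDr modn_small ?addn0 //.
    by rewrite addn0 in ltr'.
  by rewrite addn0 modn_small ?addn1 // -addn1.
(* An odd corner has its other flag at an even position: the condition on
   corners, being symmetric in the two flags of a corner, follows from chiC. *)
split=> // -[k [|]]; first by rewrite /chi addbT; apply: chiC.
move=> chi_x; set x := (k, false) : flag (bouquet_C n).
have pred_even : ~~ odd (ord_pred k).
  by have := chi_x; rewrite -chic /chi /= addbT.
have := chiC _ pred_even; rewrite -[(ord_pred k, true)]/(corner x) => chiCx.
by rewrite -[in RHS](cornerK x) chiCx cornerK.
Qed.

Lemma not_orientable_C : ~ orientable (bouquet_C n).
Proof.
have lt0 : 0.*2 < size s by rewrite size_C; lia.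
apply: (@twisted_not_orientable _ _ _ (Ordinal lt0)).
have lt3 : 2 * n + 3 < size s by rewrite size_C; lia.
have [tw2 tw1] := nth_C_twisted.
have -> : partner (C_rotationP n) (Ordinal lt0) = Ordinal lt3.
  apply: partnerE; first by rewrite -val_eqE /=; lia.
  by rewrite [nat_of_ord _]/= tw1 nth_C_first.
by rewrite /= tw1 nth_C_first.
Qed.

(** * The partial dual along the edge 3 *)

Section Label3.
Hypothesis n_gt0 : 0 < n.

Let B : {set label (2 * n + 2)} := [set e | val e == 3].
Let dual := partial_dual (bouquet_C n) B.
Let r := [rel x y : flag dual | (y == rend x) || (y == corner x)].
Let fl k (lt_k : k < size s) b : flag dual := (Ordinal lt_k, b).

(** The edge 3 occupies the positions 2 and 4n + 2. *)
Lemma absz_C3 k : k < 4 * n + 4 ->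
  (`|(s`_k)%R|%N == 3) = (k == 2) || (k == 4 * n + 2).
Proof.
move=> lt_k; have [tw2 tw1] := nth_C_twisted.
have [k_le | k_gt] := leqP k (2 * n + 1); first by rewrite nth_C_first; lia.
have [-> | k_neq2] := eqVneq k (2 * n + 2); first by rewrite tw2; lia.
have [-> | k_neq3] := eqVneq k (2 * n + 3); first by rewrite tw1; lia.
have [] := @nth_C_second (2 * n + 2 - k./2) _; first by lia.
case: (boolP (odd k)) => k_odd.
  have -> : 4 * n + 5 - 2 * (2 * n + 2 - k./2) = k by lia.
  by move=> _ ->; lia.
have -> : 4 * n + 4 - 2 * (2 * n + 2 - k./2) = k by lia.
by move=> -> _; lia.
Qed.

Lemma rend_label3 k (lt_k : k < size s) b :
  k != 2 -> k != 4 * n + 2 -> rend (fl lt_k b) = fl lt_k (~~ b).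
Proof.
move=> k2 kN; rewrite /= /dual_rend inE /= absz_C3 -?size_C //.
by rewrite (negbTE k2) (negbTE kN).
Qed.

Lemma rend_label3_first (lt2 : 2 < size s) (ltN : 4 * n + 2 < size s) b :
  rend (fl lt2 b) = fl ltN (~~ b) /\ rend (fl ltN b) = fl lt2 (~~ b).
Proof.
have s2 : (s`_2 = 3)%R by rewrite nth_C_first //; lia.
have [sN _] := @nth_C_second 1 n_gt0.
have e : 4 * n + 4 - 2 * 1 = 4 * n + 2 by lia.
rewrite e in sN.
have p2 : partner (C_rotationP n) (Ordinal lt2) = Ordinal ltN.
  by apply: partnerE; [rewrite -val_eqE /=; lia | rewrite /= s2 sN].
have pN : partner (C_rotationP n) (Ordinal ltN) = Ordinal lt2.
  by rewrite -p2 partnerK.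
rewrite /= /dual_rend !inE /= s2 sN /= /bouquet_side /= p2 pN /= s2 sN.
by [].
Qed.

Lemma connect_sym_label3 : connect_sym r.
Proof. exact: (involutions_connect_sym (@rendK _ dual) (@cornerK _ dual)). Qed.

Lemma connect_corner k (lt_k : k < size s) (lt_k1 : k.+1 < size s) :
  connect r (fl lt_k true) (fl lt_k1 false).
Proof.
apply: connect1; apply/orP; right; apply/eqP; congr (_, _).
by apply: val_inj; rewrite /= modn_small.
Qed.

(** Away from the two positions of the edge 3, the boundary of the new vertices
    runs along the boundary of the old one. *)
Lemma connect_arc i j (lt_i : i < size s) (lt_j : j < size s) :
  i <= j -> (forall k, i <= k < j -> (k != 2) && (k != 4 * n + 2)) ->
  connect r (fl lt_i false) (fl lt_j false).
Proof.
elim: j lt_j => [|j IHj] lt_j.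
  by case: i lt_i => // lt_i _ _; rewrite (bool_irrelevance lt_i lt_j) connect0.
rewrite leq_eqVlt => /predU1P[ij _ | le_ij arc].
  by subst i; rewrite (bool_irrelevance lt_i lt_j) connect0.
have lt_j' := ltnW lt_j.
have /andP[j2 jN] : (j != 2) && (j != 4 * n + 2) by apply: arc; lia.
apply: connect_trans (IHj lt_j' _ _) _; [lia | by move=> k ?; apply: arc; lia |].
apply: connect_trans (connect_corner lt_j' lt_j); apply: connect1.
by apply/orP; left; rewrite rend_label3.
Qed.

(** The untwisted ribbon 3 cuts the boundary of the vertex into two arcs, made of
    the corners 3, ..., 4n + 2 and of the other ones, and its sides close up
    each of them. *)
Lemma nb_vertices_label3 : nb_vertices dual = 2.
Proof.
pose inner (x : flag dual) := 2 < (x.1 : 'I_(size s)) + x.2 < 4 * n + 3.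
have lt0 : 0 < size s by rewrite size_C; lia.
have lt3 : 3 < size s by rewrite size_C; lia.
have lt2 : 2 < size s by rewrite size_C; lia.
have ltN : 4 * n + 2 < size s by rewrite size_C; lia.
have ltN1 : 4 * n + 3 < size s by rewrite size_C; lia.
rewrite /nb_vertices [isolated _](_ : _ = 0); last by rewrite /= addn2.
rewrite addn0.
apply: (@n_comp_two _ r inner (fl lt3 false) (fl lt0 false)).
- exact: connect_sym_label3.
- move=> x y /orP[] /eqP ->; rewrite !unfold_in; last first.
    case: x => k b; rewrite /inner /= /bouquet_corner /=.
    have sz := size_C; have ltk := ltn_ord k.
    case: b => /=.
      have [k_lt | k_ge] := ltnP k.+1 (size s); first by rewrite modn_small; lia.
      by rewrite (_ : k.+1 = size s) ?modnn; lia.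
    have [k0|k_gt0] := posnP k.
      by rewrite k0 add0n modn_small; lia.
    rewrite (_ : (k + size s).-1 = k.-1 + size s); last by lia.
    by rewrite modnDr modn_small; lia.
  case: x => -[k lt_k] b; have [k2 | k2] := eqVneq k 2.
    subst k; rewrite -[(Ordinal lt_k, b)]/(fl lt_k b).
    by rewrite (proj1 (rend_label3_first lt_k ltN b)) /inner /=; case: b; lia.
  have [kN | kN] := eqVneq k (4 * n + 2).
    subst k; rewrite -[(Ordinal lt_k, b)]/(fl lt_k b).
    by rewrite (proj2 (rend_label3_first lt2 lt_k b)) /inner /=; case: b; lia.
  rewrite -[(Ordinal lt_k, b)]/(fl lt_k b) rend_label3 // /inner /=.
  by case: b; lia.
- by rewrite /inner /=; lia.
- by rewrite /inner /=.
- case=> -[k lt_k] b; rewrite /inner /= => /andP[k_gt k_lt].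
  have [k2 | k2] := eqVneq k 2.
    have b1 : b by move: k_gt; rewrite k2; case: b {k_lt}.
    subst k; rewrite b1 connect_sym_label3; exact: connect_corner.
  apply: (@connect_trans _ _ (fl lt_k false)).
    by apply: connect_arc; [lia | move=> j; lia].
  case: b k_gt k_lt => [k_gt k_lt | _ _]; last exact: connect0.
  by apply: connect1; apply/orP; left; rewrite rend_label3 //; lia.
(* The outer arc runs forwards from position 0 to position 2, and backwards from
   position 0 to positions 4n + 3 and 4n + 2. *)
have out0 k (lt_k : k < size s) :
    k <= 2 -> connect r (fl lt0 false) (fl lt_k false).
  by move=> k2; apply: connect_arc => // j; lia.
have outN : connect r (fl lt0 false) (fl ltN1 true).
  apply: connect1; apply/orP; right; apply/eqP; congr (_, _).
  by apply: val_inj; rewrite /= size_C modn_small; lia.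
have outN' : connect r (fl lt0 false) (fl ltN1 false).
  apply: connect_trans outN (connect1 _); apply/orP; left.
  by rewrite rend_label3 //; lia.
case=> -[k lt_k] b; rewrite /inner /= => out.
have [k_lt2 | k_ge2] := ltnP k 2.
  apply: (connect_trans (out0 k lt_k _)); first exact: ltnW.
  case: b out => [out|_]; last exact: connect0.
  by apply: connect1; apply/orP; left; rewrite rend_label3 //; lia.
have [k2 | k2] := eqVneq k 2.
  subst k; case: b out => [out|_]; first by lia.
  exact: out0.
have sz := size_C.
have [kN | kN] := eqVneq k (4 * n + 2).
  subst k; case: b out => [_|]; last by lia.
  apply: (connect_trans outN'); rewrite connect_sym_label3.
  have e : 4 * n + 3 = (4 * n + 2).+1 by lia.
  move: ltN1 {outN outN'}; rewrite e => ltN1; exact: connect_corner.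
have k_eq : k = 4 * n + 3 by case: b out; lia.
subst k; rewrite (bool_irrelevance lt_k ltN1).
by case: b {out}.
Qed.

End Label3.
End Rotation.

(** * The theorem *)

(** The two rotations have the same labels at the same positions, and differ
    only in the choice of the half-edge of a twisted loop that carries the sign;
    so the identity of positions is an isomorphism. *)
Lemma C1_iso (rot : signed_rotation 4 [:: -1; -2; 3; 4; 2; 1; 3; 4]%Z) :
  ribbon_iso (bouquet_C 1) (bouquet rot).
Proof.
split=> //.
set s' := [:: _, _ & _] in rot *; set s := C_rotation 1.
pose id8 (i : 'I_(size s)) : 'I_(size s') := i.
have abs_s (i : 'I_(size s)) : `|(s'`_i)%R|%N = `|(s`_i)%R|%N.
  by case: i; do 8?[case=> //].
(* Two half-edges of the same edge have equal signs in one rotation exactly when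
   they do in the other. *)
have signs : all (fun i => all (fun j =>
    [|| i == j, `|(s`_i)%R|%N != `|(s`_j)%R|%N
     | ((s`_i < 0) == (s`_j < 0) == ((s'`_i < 0) == (s'`_j < 0)))%R])
    (iota 0 8)) (iota 0 8) by [].
have half i : val (half_label rot (id8 i)) = val (half_label (C_rotationP 1) i).
  exact: abs_s.
have same_label i :
    `|(s`_(partner (C_rotationP 1) i))%R|%N = `|(s`_i)%R|%N.
  have /eqP : half_label (C_rotationP 1) (partner (C_rotationP 1) i)
              == half_label (C_rotationP 1) i.
    by rewrite half_labelE eqxx orbT.
  by move/(congr1 val).
have partner_id i : partner rot (id8 i) = id8 (partner (C_rotationP 1) i).
  apply: partnerE; first exact: partner_neq.
  by rewrite !abs_s same_label.
exists (fun x : flag (bouquet_C 1) => (id8 x.1, x.2) : flag (bouquet rot)).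
split.
- by exists (fun x => x) => -[].
- by case=> i b; apply: val_inj; apply: half.
- by [].
- case=> i b; rewrite /= /bouquet_side /= partner_id; congr (_, _).
  have lt8 (j : 'I_(size s)) : (j : nat) \in iota 0 8.
    by rewrite mem_iota; case: j.
  have /or3P[] := allP (allP signs _ (lt8 i)) _ (lt8 (partner (C_rotationP 1) i)).
  + by rewrite val_eqE eq_sym (negbTE (partner_neq _ _)).
  + by rewrite same_label eqxx.
  by move=> /eqP ->.
by case=> i [].
Qed.

Theorem mainTheorem4 :
  (forall n : nat, (1 <= n)%N ->
     ~ orientable (bouquet_C n) /\
     ~ interpolating (partial_dual_polynomial (bouquet_C n))) /\
  (exists rot : signed_rotation 4 [:: -1; -2; 3; 4; 2; 1; 3; 4]%Z,
     ribbon_iso (bouquet_C 1) (bouquet rot)).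
Proof.
split=> [n n_gt0|]; last first.
  have rot : signed_rotation 4 [:: -1; -2; 3; 4; 2; 1; 3; 4]%Z by [].
  by exists rot; apply: C1_iso.
split; first exact: not_orientable_C.
(* The value of c, which is 1, only translates all the exponents. *)
pose c := nb_components (bouquet_C n).
have cardE : #|label (2 * n + 2)| = 2 * n + 2.
  by rewrite card_seq_sub ?iota_uniq // size_iota.
have genus A := checkerboard_euler_genus A (@checkerboard_C n).
have low :
    ((partial_dual_polynomial (bouquet_C n))`_(2 * c + 2 * n - 2) != 0)%R.
  apply/coef_partial_dual_polynomial.
  exists [set e | val e == 3]; rewrite genus nb_vertices_label3 // cardE.
  rewrite -/c; lia.
have high : ((partial_dual_polynomial (bouquet_C n))`_(2 * c + 2 * n) != 0)%R.
  apply/coef_partial_dual_polynomial; exists set0.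
  rewrite genus nb_vertices_dual0 nb_vertices_bouquet cardE -/c; lia.
move=> interp.
have /interp/(_ low high)/coef_partial_dual_polynomial[A] :
  2 * c + 2 * n - 2 <= 2 * c + 2 * n - 1 <= 2 * c + 2 * n by lia.
by rewrite genus cardE -/c; lia.
Qed.
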